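(* Let $\zeta>0$ be any constant. If the cell averages $\{\overline u_K:K\in\mathbb N_0\}$ are replaced by $\{\zeta\overline u_K:K\in\mathbb N_0\}$, then the corresponding nonlinear weights $\varpi_\ell$, $\ell=0,\dots,4$, remain unchanged. Consequently, the WENO operator $\mathcal P_{K_0}$ is homogeneous: for any constant $\zeta>0$, $\mathcal P_{K_0}(\zeta\overline u)=\zeta\,\mathcal P_{K_0}\overline u$.
   Context: $K_0$ is a target triangle of a triangular mesh in $\mathbb R^2$, with area $|K_0|$ and barycenter $(x_0,y_0)$; $K_1,K_2,K_3$ are its three edge neighbours and $K_{i1},K_{i2}$ ($i=1,2,3$) are further nearby cells lying in the same sector as $K_i$ (the sectors being cut out by the lines joining the barycenter of $K_0$ to its vertices). Stencils: $\mathbb N_0=\{K_0,K_1,K_2,K_3,K_{11},K_{12},K_{21},K_{22},K_{31},K_{32}\}$, $\mathbb N_1=\{K_0,K_1,K_2,K_3\}$, $\mathbb N_2=\{K_0,K_1,K_{11},K_{12}\}$, $\mathbb N_3=\{K_0,K_2,K_{21},K_{22}\}$, $\mathbb N_4=\{K_0,K_3,K_{31},K_{32}\}$. Given real cell averages $\overline u=\{\overline u_K\}$: $\phi_2(x,y)=\overline u_{K_0}+\sum_{j=1}^5a_j\psi_j$ and $\phi_1^{(\ell)}(x,y)=\overline u_{K_0}+\sum_{j=1}^2b_j^{(\ell)}\psi_j$, $1\le\ell\le4$, where $\psi_1=\frac{x-x_0}{\sqrt{|K_0|}}$, $\psi_2=\frac{y-y_0}{\sqrt{|K_0|}}$, and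 $\psi_3,\psi_4,\psi_5$ are $\frac{(x-x_0)(y-y_0)}{|K_0|}$, $\frac{(x-x_0)^2}{|K_0|}$, $\frac{(y-y_0)^2}{|K_0|}$ minus their respective averages over $K_0$. The coefficients are the minimizers of the least-squares problems $$\min_{\boldsymbol a\in\mathbb R^5}\sum_{K\in\mathbb N_0}\Big|\frac1{|K|}\iint_K\phi_2\,dxdy-\overline u_K\Big|^2,\qquad \min_{\boldsymbol b^{(\ell)}\in\mathbb R^2}\sum_{K\in\mathbb N_\ell}\Big|\frac1{|K|}\iint_K\phi_1^{(\ell)}\,dxdy-\overline u_K\Big|^2,$$ assumed uniquely solvable. Linear weights: $\gamma_\ell>0$, $\sum_{\ell=0}^4\gamma_\ell=1$ (in computations $\gamma_0=0.96$, $\gamma_1=\dots=\gamma_4=0.01$). Smoothness indicators: $$\beta_0=\sum_{|\boldsymbol\alpha|=1}^2\iint_{K_0}|K_0|^{|\boldsymbol\alpha|-1}(\mathcal D^{\boldsymbol\alpha}\phi_2)^2dxdy,\qquad \beta_\ell=\sum_{|\boldsymbol\alpha|=1}\iint_{K_0}(\mathcal D^{\boldsymbol\alpha}\phi_1^{(\ell)})^2dxdy,\ 1\le\ell\le4,$$ with $\boldsymbol\alpha$ a multi-index and $\mathcal D^{\boldsymbol\alpha}$ the corresponding partial derivative. $\tau=\frac14\sum_{\ell=1}^4|\beta_0-\beta_\ell|$, $\epsilon=|K_0|\max_{K\in\mathbb N_0}|\overline u_K|^2$ (recomputed from the data, so it changes when the data are scaled), and the nonlinear weights are $$\varpi_\ell=\frac{\delta_\ell}{\sum_{i=0}^4\delta_i},\qquad\delta_\ell=\gamma_\ell\Big(1+\frac{\tau^2}{(\beta_\ell+\epsilon)^2}\Big),\qquad\ell=0,\dots,4.$$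 The WENO operator is $$\mathcal P_{K_0}\overline u=\varpi_0\Big(\frac1{\gamma_0}\phi_2-\sum_{\ell=1}^4\frac{\gamma_\ell}{\gamma_0}\phi_1^{(\ell)}\Big)+\sum_{\ell=1}^4\varpi_\ell\phi_1^{(\ell)}.$$ The data are assumed not all zero on $\mathbb N_0$ so that $\epsilon>0$ (for zero data all polynomials vanish and $\mathcal P_{K_0}\overline u=0$). *)

(* Defs.v *)
From HB Require Import structures.
From mathcomp Require Import all_boot all_order all_algebra.
From mathcomp Require Import all_classical all_reals all_analysis.

Set Implicit Arguments.
Unset Strict Implicit.
Unset Printing Implicit Defensive.

Import Order.TTheory GRing.Theory Num.Theory.
Import numFieldNormedType.Exports.

Local Open Scope classical_set_scope.
Local Open Scope ring_scope.

Section Plane.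
Context {R : realType}.
Implicit Types (v : 'I_3 -> R * R) (D : set (R * R)) (f : R * R -> R).

Definition leb2 := (@lebesgue_measure R \x @lebesgue_measure R)%E.

Definition area D : R := fine (leb2 D).

Definition cell_avg D f : R := (area D)^-1 * \int[leb2]_(z in D) f z.

(* D^(a1, a2) f, the classical partial derivative
   d^(a1 + a2) f / dx^a1 dy^a2. *)
Definition pderiv (al : nat * nat) f (z : R * R) : R :=
  derive1n al.1 (fun x => derive1n al.2 (fun y => f (x, y)) z.2) z.1.

Definition barycenter v : R * R := 3^-1 *: \sum_(i < 3) v i.

Definition nondegenerate v : Prop :=
  ((v 1).1 - (v 0).1) * ((v 2).2 - (v 0).2)
  - ((v 2).1 - (v 0).1) * ((v 1).2 - (v 0).2) != 0.

(* The face spanned by the vertices in I: empty, a vertex, an edge or the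
   whole closed triangle. *)
Definition face v (I : {set 'I_3}) : set (R * R) :=
  [set z | exists w : 'I_3 -> R,
    [/\ forall i, 0 <= w i, \sum_(i in I) w i = 1
      & z = \sum_(i in I) w i *: v i]].

Definition triangle v : set (R * R) := face v [set: 'I_3].

(* The edge opposite to vertex i. *)
Definition edge v (i : 'I_3) : set (R * R) := face v [set~ i]%SET.

(* The (closed) sector with apex at the barycenter, bounded by the half-lines
   through the two endpoints of edge i. *)
Definition sector v (i : 'I_3) : set (R * R) :=
  [set z | exists w : 'I_3 -> R,
    (forall j, 0 <= w j) /\
    z = barycenter v + \sum_(j < 3 | j != i) w j *: (v j - barycenter v)].

End Plane.

(* A conforming triangulation: two distinct cells meet along a common proper
   face (nothing, a vertex or an edge). *)
Record tri_mesh (R : realType) := TriMesh {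
  cell :> finType;
  vtx : cell -> 'I_3 -> R * R;
  vtx_nondegenerate : forall K, nondegenerate (vtx K);
  conforming : forall K L, K != L -> exists I J : {set 'I_3},
    [/\ I != [set: 'I_3]%SET, J != [set: 'I_3]%SET,
        triangle (vtx K) `&` triangle (vtx L) = face (vtx K) I
      & triangle (vtx K) `&` triangle (vtx L) = face (vtx L) J]
}.

(* K_0 = target, K_(i+1) = nbr i, K_(i+1)(j+1) = far i j.  A cell lies in a
   sector when its barycenter does: an entire cell need not fit inside one
   sector.  The sector of nbr i is the one facing the edge it shares with the
   target. *)
Record weno_stencil (R : realType) (M : tri_mesh R) := WenoStencil {
  target : M;
  nbr : 'I_3 -> M;
  far : 'I_3 -> 'I_2 -> M;
  nbr_neq : forall i, nbr i != target;
  nbr_edge : forall i,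
    triangle (vtx target) `&` triangle (vtx (nbr i)) = edge (vtx target) i;
  far_neq_target : forall i j, far i j != target;
  far_neq_nbr : forall i j k, far i j != nbr k;
  far_inj : forall i, injective (far i);
  far_sector : forall i j, sector (vtx target) i (barycenter (vtx (far i j)))
}.

Section Weno.
Context {R : realType} {M : tri_mesh R}.
Variable S : weno_stencil M.
Implicit Types (u : M -> R) (z : R * R).

Local Notation K0 := (target S).
Local Notation dom K := (triangle (vtx K)).
Local Notation area0 := (area (dom K0)).

Definition big_stencil : {set M} :=
  (K0 |: [set nbr S i | i : 'I_3])
  :|: [set far S i j | i : 'I_3, j : 'I_2].

(* small_stencil l is N_(l+1). *)
Definition small_stencil (l : 'I_4) : {set M} :=
  if unlift ord0 l is Some i
  then K0 |: (nbr S i |: [set far S i j | j : 'I_2])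
  else K0 |: [set nbr S i | i : 'I_3].

Definition centered (f : R * R -> R) z : R := f z - cell_avg (dom K0) f.

(* psi j is psi_(j+1); only j < 5 is used. *)
Definition psi (j : nat) : R * R -> R :=
  let x0 := (barycenter (vtx K0)).1 in
  let y0 := (barycenter (vtx K0)).2 in
  match j with
  | 0%N => fun z => (z.1 - x0) / Num.sqrt area0
  | 1%N => fun z => (z.2 - y0) / Num.sqrt area0
  | 2%N => centered (fun z => (z.1 - x0) * (z.2 - y0) / area0)
  | 3%N => centered (fun z => (z.1 - x0) ^+ 2 / area0)
  | 4%N => centered (fun z => (z.2 - y0) ^+ 2 / area0)
  | _ => fun=> 0
  end.

(* n = 5 gives the quadratic ansatz, n = 2 the linear one. *)
Definition ansatz n u (a : 'rV[R]_n) z : R :=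
  u K0 + \sum_(j < n) a 0 j * psi j z.

Definition lsq n (N : {set M}) u (a : 'rV[R]_n) : R :=
  \sum_(K in N) `|cell_avg (dom K) (ansatz u a) - u K| ^+ 2.

Definition minimizer n (N : {set M}) u (a : 'rV[R]_n) : Prop :=
  forall b : 'rV[R]_n, lsq N u a <= lsq N u b.

Definition uniquely_solvable u : Prop :=
  (exists! a : 'rV[R]_5, minimizer big_stencil u a) /\
  (forall l, exists! b : 'rV[R]_2, minimizer (small_stencil l) u b).

(* The minimizer; the default value 0 is irrelevant under
   uniquely_solvable. *)
Definition lsq_sol n (N : {set M}) u : 'rV[R]_n := xget 0 (minimizer N u).

Definition phi2 u : R * R -> R := ansatz u (lsq_sol 5 big_stencil u).

(* phi1 l is phi_1^(l+1). *)
Definition phi1 (l : 'I_4) u : R * R -> R :=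
  ansatz u (lsq_sol 2 (small_stencil l) u).

(* Smoothness of f: sum over the multi-indices of order 1, ..., k. *)
Definition smoothness (k : nat) (f : R * R -> R) : R :=
  \sum_(al : 'I_k.+1 * 'I_k.+1 | (1 <= al.1 + al.2 <= k)%N)
    \int[leb2]_(z in dom K0)
      (area0 ^+ (al.1 + al.2).-1
       * pderiv (nat_of_ord al.1, nat_of_ord al.2) f z ^+ 2).

Definition beta u (l : 'I_5) : R :=
  if unlift ord0 l is Some l' then smoothness 1 (phi1 l' u)
  else smoothness 2 (phi2 u).

Definition tau u : R :=
  4^-1 * \sum_(l < 4) `|beta u ord0 - beta u (lift ord0 l)|.

Definition eps u : R :=
  area0 * \big[Num.max/0]_(K in big_stencil) (`|u K| ^+ 2).

Variable gamma : 'I_5 -> R.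

Definition delta u (l : 'I_5) : R :=
  gamma l * (1 + tau u ^+ 2 / (beta u l + eps u) ^+ 2).

Definition weight u (l : 'I_5) : R := delta u l / \sum_(i < 5) delta u i.

(* For data vanishing on the stencil, eps u = 0 and the quotients in delta
   take the value 0; then all the polynomials vanish, and so does weno u,
   whatever the weights. *)
Definition weno u z : R :=
  weight u ord0
    * ((gamma ord0)^-1 * phi2 u z
       - \sum_(l < 4) gamma (lift ord0 l) / gamma ord0 * phi1 l u z)
  + \sum_(l < 4) weight u (lift ord0 l) * phi1 l u z.

End Weno.

(* Main.v *)
Require Import Defs.
From mathcomp Require Import all_boot all_order all_algebra.
From mathcomp Require Import all_classical all_reals all_analysis.
Import Order.TTheory GRing.Theory Num.Theory.
Import numFieldNormedType.Exports.
Local Open Scope ring_scope.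

(** Every ingredient of the reconstruction is homogeneous under scaling of the
    data by k > 0, and the weights are built to have degree 0.

    The ansatz is linear in the pair (data, coefficients), so the least-squares
    functional at (k u, k a) is k^2 times its value at (u, a) ([lsqZ]).
    Scaling by k is therefore a bijection between the minimizers for u and
    those for k u, and uniqueness turns this into an equality of the solutions
    ([lsq_solZ]): the polynomials phi_2 and phi_1 scale by k ([phi2Z],
    [phi1Z]).  The smoothness indicators are quadratic in the derivatives, so
    beta, tau and eps all have degree 2 ([betaZ], [tauZ], [epsZ]).  Hence the
    numerator and the denominator of tau^2 / (beta + eps)^2 both have degree 4
    and the factor k^4 cancels ([delta_scale_invariant]).  The WENO
    reconstruction is then a combination, with unchanged coefficients, of
    polynomials that scale by k ([wenoZ]).

    The cell averages are integrals of the ansatz over triangles, and the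
    indicators integrals of squares of its derivatives.  Instead of checking that the triangles are measurable and that
    the polynomials are integrable and differentiable, the scaling laws of
    integrals and derivatives are proved for arbitrary functions
    ([Rintegral_gt0Zl], [derive1_Zl]), the conventional values of divergent
    limits and infinite integrals being 0 and hence scaling as well. *)

(** The integral of a nonnegative function is the supremum of the integrals of
    the simple functions below it.  Multiplying those below f by k gives simple
    functions below k f, whence one inequality; the other one is the same
    inequality for k^-1 and k f. *)
Lemma ge0_integral_gt0Zl d (T : measurableType d) (R : realType)
    (mu : {measure set T -> \bar R}) (k : R) (f : T -> \bar R) :
  0 < k -> (forall x, (0 <= f x)%E) ->
  (\int[mu]_x (k%:E * f x) = k%:E * \int[mu]_x f x)%E.
Proof.
have half (c : R) (g : T -> \bar R) : 0 < c -> (forall x, (0 <= g x)%E) ->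
    (c%:E * \int[mu]_x g x <= \int[mu]_x (c%:E * g x))%E.
  move=> c0 g0; rewrite !ge0_integralTE//; last first.
    by move=> x; rewrite mule_ge0// lee_fin ltW.
  rewrite -ereal_supZl ?(ltW c0)//; last first.
    by apply/set0P; eexists; exists nnsfun0; [exact: g0|].
  apply: ereal_sup_le => _ [_ [h /= hg <-] <-].
  exists (scale_nnsfun h (ltW c0)); last exact: sintegralrM.
  by move=> x /=; rewrite EFinM lee_pmul2l ?lte_fin.
move=> k0 f0; apply/eqP; rewrite eq_le half// andbT.
have kf0 x : (0 <= k%:E * f x)%E by rewrite mule_ge0// lee_fin ltW.
have := half k^-1 (fun x => k%:E * f x)%E; rewrite invr_gt0 => /(_ k0 kf0).
under [in leRHS]eq_integral do rewrite muleA -EFinM mulVf ?gt_eqF// mul1e.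
by rewrite -(@lee_pmul2l _ k%:E)// muleA -EFinM divff ?gt_eqF// mul1e.
Qed.

(** When the positive or the negative part has infinite integral, so does its
    multiple by k, and both sides are 0 because [fine] sends the infinities
    to 0. *)
Lemma Rintegral_gt0Zl d (T : measurableType d) (R : realType)
    (mu : {measure set T -> \bar R}) (D : set T) (k : R) (f : T -> R) :
  0 < k -> \int[mu]_(x in D) (k * f x) = k * \int[mu]_(x in D) f x.
Proof.
move=> k0; rewrite /Rintegral.
under eq_integral do rewrite EFinM.
rewrite integral_mkcond [in RHS]integral_mkcond erestrict_scale.
set g := patch _ _ _; rewrite integralE [in RHS]integralE.
rewrite ge0_funeposM ?ltW// ge0_funenegM ?ltW//.
rewrite !ge0_integral_gt0Zl//.
case: (integral _ _ g^\+%E) => [a| |]; case: (integral _ _ g^\-%E) => [b| |];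
  rewrite ?gt0_muley ?gt0_muleNy ?lte_fin//= ?mulr0//.
by rewrite -mulrBr.
Qed.

(** For k != 0 the difference quotients of k f and of f converge together; when
    they diverge, both derivatives take the default value 0. *)
Lemma derive1_Zl (R : realType) (k : R) (f : R -> R) :
  k != 0 -> derive1 (fun x => k * f x) = (fun x => k * derive1 f x).
Proof.
move=> k0; apply/funext => a; rewrite /derive1.
set q := (fun h => h^-1 *: (f (h + a) - f a)).
rewrite (_ : (fun h => _) = k *: q); last first.
  by apply/funext => h; rewrite /q /= /GRing.scale /= -mulrBr mulrCA.
have [cq|ncq] := pselect (cvg (q @ 0^'))%classic; first exact: limZl_tmp.
have nckq : ~ cvg ((k *: q) @ 0^')%classic by rewrite is_cvgZlE.
by rewrite (dvgP nckq) (dvgP ncq) mulr0.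
Qed.

Lemma derive1n_Zl (R : realType) (k : R) n (f : R -> R) :
  k != 0 -> derive1n n (fun x => k * f x) = (fun x => k * derive1n n f x).
Proof. by move=> k0; elim: n => //= n ->; rewrite derive1_Zl. Qed.

Lemma pderivZ (R : realType) (k : R) al (f : R * R -> R) :
  k != 0 -> pderiv al (fun z => k * f z) = (fun z => k * pderiv al f z).
Proof.
move=> k0; apply/funext => z; rewrite /pderiv.
rewrite (_ : (fun x => _) =
  (fun x => k * derive1n al.2 (fun y => f (x, y)) z.2)).
  by rewrite derive1n_Zl.
by apply/funext => x; rewrite derive1n_Zl.
Qed.

Lemma cell_avgZ (R : realType) (D : set (R * R)) (k : R) (f : R * R -> R) :
  0 < k -> cell_avg D (fun z => k * f z) = k * cell_avg D f.
Proof. by move=> k0; rewrite /cell_avg Rintegral_gt0Zl// mulrCA. Qed.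

Section Homogeneity.
Context {R : realType} {M : tri_mesh R}.
Variables (S : weno_stencil M) (k : R).
Hypothesis k_gt0 : 0 < k.
Implicit Types (u : M -> R) (N : {set M}).

Let k_neq0 : k != 0. Proof. exact: lt0r_neq0. Qed.

Lemma ansatzZ n u (a : 'rV[R]_n) :
  ansatz S (fun K => k * u K) (k *: a) = (fun z => k * ansatz S u a z).
Proof.
apply/funext => z; rewrite /ansatz mulrDr mulr_sumr; congr (_ + _).
by apply: eq_bigr => j _; rewrite mxE mulrA.
Qed.

Lemma lsqZ n N u (a : 'rV[R]_n) :
  lsq S N (fun K => k * u K) (k *: a) = k ^+ 2 * lsq S N u a.
Proof.
rewrite /lsq mulr_sumr; apply: eq_bigr => K _.
by rewrite ansatzZ cell_avgZ// -mulrBr normrM exprMn (gtr0_norm k_gt0).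
Qed.

(** As k is invertible, every competitor b is k times another one, so scaling
    the objective by k^2 preserves minimality in both directions. *)
Lemma minimizerZ n N u (a : 'rV[R]_n) :
  minimizer S N (fun K => k * u K) (k *: a) <-> minimizer S N u a.
Proof.
split=> mina b; first by have := mina (k *: b); rewrite !lsqZ ler_pM2l ?exprn_gt0.
by rewrite -[b](scalerKV k_neq0) !lsqZ ler_pM2l ?exprn_gt0.
Qed.

(** Uniqueness is what makes this hold: the choice operator selecting a
    minimizer need not commute with scaling if there are several. *)
Lemma lsq_solZ n N u : (exists! a : 'rV[R]_n, minimizer S N u a) ->
  lsq_sol S n N (fun K => k * u K) = k *: lsq_sol S n N u.
Proof.
move=> [a [mina uniqa]]; rewrite /lsq_sol.
rewrite (@xget_unique _ 0 (minimizer S N u) a)//; last first.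
  by move=> b /uniqa.
apply: xget_unique; first exact/minimizerZ.
move=> b minb; rewrite -[b](scalerKV k_neq0); congr (_ *: _).
by symmetry; apply: uniqa; rewrite -minimizerZ scalerKV.
Qed.

Lemma smoothnessZ n (f : R * R -> R) :
  smoothness S n (fun z => k * f z) = k ^+ 2 * smoothness S n f.
Proof.
rewrite /smoothness mulr_sumr; apply: eq_bigr => al _.
rewrite -Rintegral_gt0Zl ?exprn_gt0//; congr Rintegral.
by apply/funext => z; rewrite pderivZ// exprMn mulrCA.
Qed.

Lemma epsZ u : eps S (fun K => k * u K) = k ^+ 2 * eps S u.
Proof.
rewrite /eps mulrCA; congr (_ * _).
rewrite (big_morph (fun x => k ^+ 2 * x) (id1 := 0) (op1 := Num.max)).
- by apply: eq_bigr => K _; rewrite normrM exprMn (gtr0_norm k_gt0).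
- by move=> x y; rewrite maxr_pMr// sqr_ge0.
- by rewrite mulr0.
Qed.

Section Solvable.
Variable u : M -> R.
Hypothesis solvable : uniquely_solvable S u.

Lemma phi2Z : phi2 S (fun K => k * u K) = (fun z => k * phi2 S u z).
Proof. by rewrite /phi2 lsq_solZ ?ansatzZ//; case: solvable. Qed.

Lemma phi1Z l : phi1 S l (fun K => k * u K) = (fun z => k * phi1 S l u z).
Proof. by rewrite /phi1 lsq_solZ ?ansatzZ//; case: solvable. Qed.

Lemma betaZ l : beta S (fun K => k * u K) l = k ^+ 2 * beta S u l.
Proof.
by rewrite /beta; case: unliftP => [l' _|_]; rewrite ?phi1Z ?phi2Z smoothnessZ.
Qed.

Lemma tauZ : tau S (fun K => k * u K) = k ^+ 2 * tau S u.
Proof.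
rewrite /tau mulrCA; congr (_ * _); rewrite mulr_sumr; apply: eq_bigr => l _.
by rewrite !betaZ -mulrBr normrM (ger0_norm (sqr_ge0 k)).
Qed.

(** The common factor k^4 is a unit, so it cancels in the totalized quotient
    whatever the value of the denominator. *)
Lemma delta_scale_invariant (gamma : 'I_5 -> R) l :
  delta S gamma (fun K => k * u K) l = delta S gamma u l.
Proof.
rewrite /delta tauZ betaZ epsZ -mulrDr !(exprMn _ (k ^+ 2)).
by rewrite -mulf_div divff ?mul1r// !expf_neq0.
Qed.

Lemma weight_scale_invariant (gamma : 'I_5 -> R) l :
  weight S gamma (fun K => k * u K) l = weight S gamma u l.
Proof.
rewrite /weight delta_scale_invariant; congr (_ / _).
by apply: eq_bigr => i _; rewrite delta_scale_invariant.
Qed.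

Lemma wenoZ (gamma : 'I_5 -> R) z :
  weno S gamma (fun K => k * u K) z = k * weno S gamma u z.
Proof.
rewrite /weno phi2Z weight_scale_invariant.
under [in LHS]eq_bigr do rewrite phi1Z mulrCA.
under [X in _ + X = _]eq_bigr do rewrite phi1Z weight_scale_invariant mulrCA.
by rewrite -!mulr_sumr mulrCA -mulrBr mulrCA -mulrDr.
Qed.

End Solvable.
End Homogeneity.

Theorem lemma3p1 (R : realType) (M : tri_mesh R) (S : weno_stencil M)
    (gamma : 'I_5 -> R)
    (gamma_gt0 : forall l, 0 < gamma l)
    (gamma_sum : \sum_(l < 5) gamma l = 1)
    (u : M -> R) (solvable : uniquely_solvable S u)
    (zeta : R) (zeta_gt0 : 0 < zeta) :
  ((exists2 K, K \in big_stencil S & u K != 0) ->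
     forall l : 'I_5,
       weight S gamma (fun K => zeta * u K) l = weight S gamma u l) /\
  (forall z : R * R,
     weno S gamma (fun K => zeta * u K) z = zeta * weno S gamma u z).
Proof. by split=> [_ l|z]; [exact: weight_scale_invariant|exact: wenoZ]. Qed.
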